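(* Let $D$ be a finite or infinite digraph. (a) The following are equivalent: (i) $D$ has a point-basis; (ii) $D$ has an arc-basis; (iii) the shadow of every vertex of $D$ contains an initial strong component of $D$; (iv) the shadow (in $D^*$) of every vertex of the condensation $D^*$ contains a source of $D^*$; (v) every point-reaching set of $D$ contains a point-basis of $D$; (vi) every arc-reaching set of $D$ contains an arc-basis of $D$. (b) A point-basis and an arc-basis of $D$ exist whenever $D^*$ contains no in-ray; in particular, whenever $D$ has only finitely many strong components, and in particular whenever $D$ is finite.
   Context: $D$ is a digraph with vertex set $X(D)$ (arcs are ordered pairs of distinct vertices), possibly infinite. $v$ is reachable from $u$ if there is a directed path (possibly of length $0$) from $u$ to $v$. The shadow of $u$ is the set of vertices from which $u$ is reachable. A strong component is a maximal subdigraph in which every vertex is reachable from every other; it is initial if no arc enters it from outside. A source is a vertex of in-degree $0$. The condensation $D^*$ has one vertex for each strong component of $D$, with an arc $(C_1,C_2)$ iff $C_1\ne C_2$ and some arc $(u,v)$ of $D$ has $u\in C_1$, $v\in C_2$. An in-ray in a digraph is a one-way infinite directed path $(\dots,v_2,v_1,v_0)$ whose vertex set is not contained in the union of finitely many strong components of that digraph. A point-reaching set is $S\subseteq X(D)$ such that every vertex is reachable from some vertex of $S$; a point-basis is an inclusion-minimal point-reaching set. An arc-reaching set is $S\subseteq X(D)$ such that for every arc $(u,v)$, $u$ is reachable from some vertex of $S$; an arc-basis is an inclusion-minimal arc-reaching set. *)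

(* Defs.v *)
From mathcomp Require Import all_boot.
From mathcomp Require Import boolp classical_sets functions cardinality.

Set Implicit Arguments.
Unset Strict Implicit.
Unset Printing Implicit Defensive.

Local Open Scope classical_set_scope.

Record digraph := Digraph {
  vertex :> Type;
  arc : vertex -> vertex -> Prop;
  arc_irrefl : forall u, ~ arc u u }.

(* A directed path u = p 0 -> p 1 -> ... -> p n = v with pairwise distinct
   vertices; the values of p beyond n are irrelevant, and n = 0 is allowed.
   Stated for a bare relation so that it applies to subdigraphs as well. *)
Definition reach (T : Type) (A : T -> T -> Prop) (u v : T) : Prop :=
  exists (n : nat) (p : nat -> T),
    [/\ p 0 = u, p n = v,
        (forall i, i < n -> A (p i) (p i.+1)) &
        (forall i j, i <= n -> j <= n -> p i = p j -> i = j)].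

Definition reachable (D : digraph) (u v : D) : Prop := reach (@arc D) u v.

Definition shadow (D : digraph) (u : D) : set D := [set v | reachable v u].

Definition source (D : digraph) (v : D) : Prop := forall u : D, ~ arc u v.

(* Subdigraphs need not be induced. *)
Record subdigraph (D : digraph) := Subdigraph {
  sub_vertices : set D;
  sub_arc : D -> D -> Prop;
  sub_arcP : forall u v, sub_arc u v ->
    [/\ arc u v, sub_vertices u & sub_vertices v] }.

Definition subdigraph_le (D : digraph) (H K : subdigraph D) : Prop :=
  sub_vertices H `<=` sub_vertices K /\
  (forall u v, sub_arc H u v -> sub_arc K u v).

(* Nonemptiness only matters when D itself is empty: it keeps the empty
   subdigraph from being a strong component of the empty digraph. *)
Definition strong (D : digraph) (H : subdigraph D) : Prop :=
  sub_vertices H !=set0 /\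
  (forall u v, sub_vertices H u -> sub_vertices H v -> reach (sub_arc H) u v).

Definition strong_component (D : digraph) (C : subdigraph D) : Prop :=
  strong C /\ (forall K, strong K -> subdigraph_le C K -> K = C).

Definition initial (D : digraph) (C : subdigraph D) : Prop :=
  forall u v : D, arc u v -> sub_vertices C v -> sub_vertices C u.

Section Condensation.
Variable D : digraph.

Definition component : Type := {C : subdigraph D | strong_component C}.

Definition component_arc (C1 C2 : component) : Prop :=
  C1 <> C2 /\
  exists u v : D,
    [/\ arc u v, sub_vertices (sval C1) u & sub_vertices (sval C2) v].

Lemma component_arc_irrefl C : ~ component_arc C C.
Proof. by case. Qed.

Definition condensation : digraph := Digraph component_arc_irrefl.

End Condensation.

(* r enumerates the path ( ..., v_2, v_1, v_0) backwards: r i is v_i. *)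
Definition in_ray (D : digraph) (r : nat -> D) : Prop :=
  [/\ injective r,
      (forall i, arc (r i.+1) (r i)) &
      ~ exists F : set (subdigraph D),
          [/\ finite_set F,
              F `<=` [set C | strong_component C] &
              range r `<=` \bigcup_(C in F) sub_vertices C]].

Definition point_reaching (D : digraph) (S : set D) : Prop :=
  forall v : D, exists2 s, S s & reachable s v.

Definition arc_reaching (D : digraph) (S : set D) : Prop :=
  forall u v : D, arc u v -> exists2 s, S s & reachable s u.

Definition inclusion_minimal (T : Type) (P : set T -> Prop) (S : set T) : Prop :=
  P S /\ (forall S', P S' -> S' `<=` S -> S' = S).

Definition point_basis (D : digraph) (S : set D) : Prop :=
  inclusion_minimal (@point_reaching D) S.

Definition arc_basis (D : digraph) (S : set D) : Prop :=
  inclusion_minimal (@arc_reaching D) S.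

(* Main.v *)
Require Import Defs.
From mathcomp Require Import all_boot.
From mathcomp Require Import boolp classical_sets functions cardinality.

Local Open Scope classical_set_scope.

(** Points and arcs are treated together. For a set [T] of targets containing
    every tail of an arc, a minimal set [S] reaching [T] consists of vertices of
    initial components: an arc entering the component of [s] has a tail reached
    by some other element of [S], which would make [s] redundant. Conversely, if
    every vertex is reachable from an initial component, then picking from a
    set [S] reaching [T] one vertex in each initial component that meets [T]
    gives a minimal set reaching [T]. Point-bases are the case where [T]
    consists of all vertices, arc-bases the case where it consists of the tails.
    Without such initial components, walking backwards in the acyclic
    condensation gives an in-ray. *)

Set Implicit Arguments.
Unset Strict Implicit.
Unset Printing Implicit Defensive.

(* [path.arc] would otherwise take precedence. *)
Local Notation arc := Defs.arc.

(** * Directed reachability *)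

Section Reach.
Variables (T : Type) (A : T -> T -> Prop).

Lemma reach_refl u : reach A u u.
Proof.
by exists 0, (fun=> u); split=> // i j; rewrite !leqn0 => /eqP-> /eqP->.
Qed.

(** Paths have distinct vertices, so [u] can be prepended only if it is absent from the path. If it
    occurs at position [k], the part of the path from [k] on already works. *)
Lemma reach_cons u v w : A u v -> reach A v w -> reach A u w.
Proof.
move=> Auv [n [p [p0 pn pA pinj]]].
have [[k [lekn pku]]|fresh_u] := pselect (exists k, k <= n /\ p k = u).
  exists (n - k), (fun i => p (k + i)); split; rewrite ?addn0 ?subnKC //.
  - by move=> i lti; rewrite addnS; apply: pA; rewrite -ltn_subRL.
  - move=> i j lei lej /pinj; rewrite -!leq_subRL // => /(_ lei lej)/eqP.
    by rewrite eqn_add2l => /eqP.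
exists n.+1, (fun i => if i is j.+1 then p j else u); split=> //.
- by case=> [|i] lti; [rewrite p0 | apply: pA].
- case=> [|i] [|j] // lei lej eq_p; last by congr _.+1; apply: pinj.
    by case: fresh_u; exists j.
  by case: fresh_u; exists i.
Qed.

(** With this principle [reach] behaves as a reflexive transitive closure, and later proofs need not
    handle paths or the distinctness of their vertices. *)
Lemma reach_ind_head (P : T -> T -> Prop) :
  (forall u, P u u) ->
  (forall u v w, A u v -> reach A v w -> P v w -> P u w) ->
  forall u v, reach A u v -> P u v.
Proof.
move=> Prefl Pcons u v [n [p]].
elim: n u p => [|n IHn] u p [p0 pn pA pinj]; first by rewrite -p0 -pn.
have tail : [/\ p 1 = p 1, p n.+1 = v,
    (forall i, i < n -> A (p i.+1) (p i.+2)) &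
    (forall i j, i <= n -> j <= n -> p i.+1 = p j.+1 -> i = j)].
  split=> // [i lti | i j lei lej eq_p]; first exact: pA.
  by apply/eqP; rewrite -eqSS; apply/eqP/pinj.
apply: (Pcons _ (p 1)); first by rewrite -p0; apply: pA.
  by exists n, (fun i => p i.+1).
exact: IHn tail.
Qed.

Lemma reach_trans v u w : reach A u v -> reach A v w -> reach A u w.
Proof.
move: u v; apply: reach_ind_head => // u v z Auv _ IH /IH.
exact: reach_cons.
Qed.

Lemma reach_arc u v : A u v -> reach A u v.
Proof. by move=> Auv; apply: reach_cons Auv (reach_refl v). Qed.

Lemma reach_last u v : reach A u v -> u = v \/ exists2 w, reach A u w & A w v.
Proof.
move: u v; apply: reach_ind_head => [u|u v w Auv _]; first by left.
case=> [<-|[z rvz Azw]]; right; first by exists u; first exact: reach_refl.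
by exists z => //; apply: reach_cons rvz.
Qed.

End Reach.

(** Each arc on a path from [u] to [v] has a tail reachable from [u] and a head reaching [v], so
    only such arcs must belong to [B]. This transfers reachability between a digraph and its
    subdigraphs. *)
Lemma reach_restrict (T : Type) (A B : T -> T -> Prop) u v :
  (forall x y, A x y -> reach A u x -> reach A y v -> B x y) ->
  reach A u v -> reach B u v.
Proof.
move=> AB ruv; suff : forall x y, reach A x y ->
    reach A u x -> y = v -> reach B x y by apply=> //; apply: reach_refl.
apply: reach_ind_head => [x _ _|x y z Axy ryz IH rux eq_z].
  exact: reach_refl.
apply: (@reach_cons _ _ _ y); first by apply: AB => //; rewrite -eq_z.
by apply: IH => //; apply: reach_trans rux (reach_arc Axy).
Qed.

(** * Strong components and the condensation *)

Section Components.
Variable D : digraph.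
Implicit Types (u v w : D) (C : subdigraph D) (c d : condensation D).

Definition mutual v : set D := [set w | reachable v w /\ reachable w v].

(** Membership in an initial strong component, phrased by reachability alone; equivalently, the
    class of [v] is a source of the condensation. *)
Definition bottom v : Prop := forall w, reachable w v -> reachable v w.

Lemma mutual_refl v : mutual v v.
Proof. by split; apply: reach_refl. Qed.

Lemma mutual_eq v w : mutual v w -> mutual w = mutual v.
Proof.
move=> [rvw rwv]; rewrite eqEsubset; split=> x [r1 r2]; split.
- exact: reach_trans rvw r1.
- exact: reach_trans r2 rwv.
- exact: reach_trans rwv r1.
- exact: reach_trans r2 rvw.
Qed.

Lemma bottom_mutual v w : bottom v -> mutual v w -> bottom w.
Proof.
move=> bv [rvw rwv] x rxw; apply: (reach_trans rwv).
by apply: bv; apply: reach_trans rxw rwv.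
Qed.

Lemma subdigraph_eq (H K : subdigraph D) :
  sub_vertices H = sub_vertices K ->
  (forall u v, sub_arc H u v <-> sub_arc K u v) -> H = K.
Proof.
case: H K => [V a aP] [W b bP] /= VW ab; subst W.
have ? : a = b by apply/funext => u; apply/funext => v; apply/propext.
by subst b; congr Subdigraph; apply: Prop_irrelevance.
Qed.

(** A tautology whose shape matters: in [component_of], unification reads the vertex set and the arc
    relation off it. *)
Lemma component_of_subproof v u w :
  [/\ arc u w, mutual v u & mutual v w] -> [/\ arc u w, mutual v u & mutual v w].
Proof. by []. Qed.

Definition component_of v : subdigraph D :=
  Subdigraph (@component_of_subproof v).

Lemma strong_component_of v : strong (component_of v).
Proof.
split; first by exists v; apply: mutual_refl.
move=> x y [rvx rxv] [rvy ryv].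
(* A path between two vertices of the class never leaves it: all its vertices are reachable from [v]
   and reach [v]. *)
apply: (@reach_restrict _ (@Defs.arc D)); last exact: reach_trans rxv rvy.
move=> a b ab rxa rby; split=> //; split.
- exact: reach_trans rvx rxa.
- exact: reach_trans (reach_arc ab) (reach_trans rby ryv).
- exact: reach_trans rvx (reach_trans rxa (reach_arc ab)).
- exact: reach_trans rby ryv.
Qed.

Lemma strong_reachable C u v :
  strong C -> sub_vertices C u -> sub_vertices C v -> reachable u v.
Proof.
move=> [_ sC] Cu Cv; apply: reach_restrict (sC _ _ Cu Cv) => x y.
by move=> /sub_arcP[].
Qed.

Lemma strong_le_component_of C v :
  strong C -> sub_vertices C v -> subdigraph_le C (component_of v).
Proof.
move=> sC Cv.
have sub x : sub_vertices C x -> mutual v x.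
  by move=> Cx; split; apply: strong_reachable sC _ _.
by split=> // x y /sub_arcP[axy Cx Cy]; split=> //; apply: sub.
Qed.

Lemma component_ofP v : strong_component (component_of v).
Proof.
split=> [|K sK [leV leA]]; first exact: strong_component_of.
have [leV' leA'] := strong_le_component_of sK (leV _ (mutual_refl v)).
apply: subdigraph_eq => [|x y]; first by rewrite eqEsubset.
by split=> [/leA'|/leA].
Qed.

Lemma strong_componentE C v :
  strong_component C -> sub_vertices C v -> C = component_of v.
Proof.
move=> [sC maxC] Cv; apply/esym/maxC; first exact: strong_component_of.
exact: strong_le_component_of.
Qed.

Lemma strong_component_witness C :
  strong_component C -> exists v, C = component_of v.
Proof.
move=> CC; have [[[v Cv] _] _] := CC.
by exists v; apply: strong_componentE.
Qed.

Lemma initial_component_of v : initial (component_of v) <-> bottom v.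
Proof.
split=> [iv w | bv x y axy [rvy ryv]].
  (* Being initial concerns single arcs, so membership in the class is pulled back along a path arc
     by arc. *)
  suff: forall x y, reachable x y -> mutual v y -> mutual v x.
    by move=> H /H/(_ (mutual_refl v)) [].
  apply: reach_ind_head => // x y z axy _ IH /IH.
  exact: iv.
have rxv := reach_cons axy ryv.
by split=> //; apply: bv.
Qed.

Definition class_of v : condensation D := exist _ _ (component_ofP v).

Lemma component_sval_inj (c d : component D) : sval c = sval d -> c = d.
Proof. by case: c d => [C CP] [E EP]; apply: eq_exist. Qed.

Lemma class_ofP c v : sub_vertices (sval c) v -> c = class_of v.
Proof.
by move=> cv; apply: component_sval_inj; apply: strong_componentE (svalP c) cv.
 Qed.

Lemma class_of_surj c : exists v, c = class_of v.
Proof.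
have [[[v cv] _] _] := svalP c.
by exists v; apply: class_ofP.
Qed.

Lemma class_of_eq v w : class_of v = class_of w <-> mutual v w.
Proof.
split=> [eq_vw | vw]; last exact: class_ofP.
have : sub_vertices (sval (class_of w)) w by apply: mutual_refl.
by rewrite -eq_vw.
Qed.

Lemma class_of_reach u v : reachable (class_of u) (class_of v) <-> reachable u v.
Proof.
split=> [ruv|].
  (* The representatives are arbitrary because a path of the condensation may enter and leave a
     class at different vertices; strongness joins them. *)
  suff: forall c d, reachable c d -> forall x y,
      sub_vertices (sval c) x -> sub_vertices (sval d) y -> reachable x y.
    by apply; [exact: ruv | exact: mutual_refl | exact: mutual_refl].
  apply: reach_ind_head => [c x y | c d e [_ [a [b [ab ca db]]]] _ IH x y cx ey].
    exact: strong_reachable (svalP c).1.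
  apply: reach_trans (strong_reachable (svalP c).1 cx ca) _.
  exact: reach_cons ab (IH _ _ db ey).
move: u v; apply: reach_ind_head => [u|u v w auv _ IH]; first exact: reach_refl.
(* An arc inside one class gives no arc of the condensation and is skipped. *)
have [->//|neq] := pselect (class_of u = class_of v).
apply: reach_cons IH; split=> //; exists u, v.
by split=> //; apply: mutual_refl.
Qed.

Lemma condensation_reach_antisym c d : reachable c d -> reachable d c -> c = d.
Proof.
have [u ->] := class_of_surj c; have [v ->] := class_of_surj d.
by rewrite !class_of_reach class_of_eq.
Qed.

Lemma source_class_of v : source (class_of v) <-> bottom v.
Proof.
split=> [sv w /class_of_reach rwv | bv c].
  have [/class_of_eq[]//|[c _ acv]] := reach_last rwv.
  by case: (sv c).
move=> [neq [x [y [axy cx [rvy ryv]]]]]; apply: neq.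
rewrite (class_ofP cx) class_of_eq; have rxv := reach_cons axy ryv.
by split=> //; apply: bv.
Qed.

(** The common form through which the equivalent conditions are compared. *)
Definition bottom_reaching : Prop :=
  forall u, exists2 v, bottom v & reachable v u.

Lemma bottom_reaching_initial :
  bottom_reaching <-> forall u, exists C,
    [/\ strong_component C, initial C & sub_vertices C `<=` shadow u].
Proof.
split=> H u.
  have [v bv rvu] := H u; exists (component_of v).
  split; [exact: component_ofP | exact/initial_component_of|].
  by move=> w [_ rwv]; apply: reach_trans rwv rvu.
have [C [/strong_component_witness[v ->] /initial_component_of bv sub]] := H u.
by exists v => //; apply/sub/mutual_refl.
Qed.

Lemma bottom_reaching_source :
  bottom_reaching <-> forall c, exists2 s : condensation D,
    source s & shadow c s.
Proof.
split=> [H c | H u].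
  have [u ->] := class_of_surj c; have [v bv rvu] := H u.
  by exists (class_of v); [apply/source_class_of | apply/class_of_reach].
have [s] := H (class_of u); have [v ->] := class_of_surj s.
by move=> /source_class_of bv /class_of_reach rvu; exists v.
Qed.

End Components.

(** * Minimal sets reaching a given set of targets *)

Section Bases.
Variables (D : digraph) (targets : set D).
Hypothesis arc_targets : forall u v : D, arc u v -> targets u.

Definition target_reaching (S : set D) : Prop :=
  forall u, targets u -> exists2 s, S s & reachable s u.

Lemma target_reachingT : target_reaching setT.
Proof. by move=> u _; exists u => //; apply: reach_refl. Qed.

Lemma bottom_target_basis (S : set D) s :
  inclusion_minimal target_reaching S -> S s -> bottom s.
Proof.
move=> [reachS minS] Ss.
(* A private target of [s]: if every target reached from [s] were also reached from another element
   of [S], deleting [s] would contradict minimality. *)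
have [t [Tt rst only_s]] : exists t, [/\ targets t, reachable s t &
    forall s', S s' -> reachable s' t -> s' = s].
  apply: contrapT => none.
  suff eqS : S `\ s = S by move: Ss; rewrite -eqS => -[_]; apply.
  apply: minS => [u Tu|]; last exact: subDsetl.
  have [s' Ss' rs'u] := reachS u Tu.
  have [eq_s|neq] := pselect (s' = s); last by exists s'.
  have [[s2 [Ss2 rs2 neq2]]|alone] := pselect (exists s2,
    [/\ S s2, reachable s2 u & s2 <> s]); first by exists s2.
  case: none; exists u; split=> //; first by rewrite -eq_s.
  by move=> s2 Ss2 rs2; apply: contrapT => neq; apply: alone; exists s2.
suff back : forall x y, reachable x y -> reachable s y -> reachable y s ->
    reachable s x.
  by move=> w rws; apply: back rws (reach_refl _ s) (reach_refl _ s).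
apply: reach_ind_head => // x y z axy ryz IH rsz rzs.
(* The tail [x] is a target, and any element of [S] reaching it reaches [t] through [s], hence
   equals [s]. *)
have [s' Ss' rs'x] := reachS x (arc_targets axy).
suff <- : s' = s by [].
apply: only_s => //; apply: reach_trans rst.
exact: reach_trans rs'x (reach_cons axy (reach_trans ryz rzs)).
Qed.

Lemma target_basis_bottom_reaching (S : set D) :
  inclusion_minimal target_reaching S -> bottom_reaching D.
Proof.
move=> basisS u.
have [[w awu]|src] := pselect (exists w, arc w u).
  have [s Ss rsw] := basisS.1 _ (arc_targets awu).
  exists s; first exact: bottom_target_basis basisS Ss.
  exact: reach_trans rsw (reach_arc awu).
(* A vertex without in-neighbours may fail to be a target, so [S] need not reach it, but it is
   itself [bottom]. *)
exists u; last exact: reach_refl.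
move=> w rwu; have [->|[x _ axu]] := reach_last rwu; first exact: reach_refl.
by case: src; exists x.
Qed.

Lemma bottom_reaching_target_basis (S : set D) :
  bottom_reaching D -> target_reaching S ->
  exists2 B, B `<=` S & inclusion_minimal target_reaching B.
Proof.
move=> bot reachS.
(* Choosing a subset with at most one element, rather than an element, also covers the empty set. *)
have /choice[f fP] (A : set D) : exists Y : set D,
    [/\ Y `<=` A, (forall x y, Y x -> Y y -> x = y) & A !=set0 -> Y !=set0].
  have [[a Aa]|A0] := pselect (A !=set0).
    exists [set a]; split=> [x -> //|x y -> -> //|_].
    by exists a.
  by exists set0; split.
(* The argument of [f] depends only on the class of [s], so at most one vertex per initial component
   is kept; the last condition discards components without targets. *)
pose B := [set s | [/\ f (S `&` mutual s) s, bottom s &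
  exists2 t, mutual s t & targets t]].
exists B => [s [fs _ _]|].
  by have [sub _ _] := fP (S `&` mutual s); case: (sub _ fs).
split=> [u Tu|S' reachS' subS'].
  have [v bv rvu] := bot u.
  (* Either the path from [v] to [u] is trivial and [v] is the target [u], or its first arc has tail
     [v]. *)
  have Tv : targets v.
    move: (rvu) => [[|n] [p [<- pn pA _]]]; first by rewrite pn.
    exact: arc_targets (pA 0 _).
  have [s0 Ss0 rs0v] := reachS v Tv.
  have [subf _ nef] := fP (S `&` mutual v).
  have [|s fs] := nef; first by exists s0; split=> //; split=> //; apply: bv.
  have [Ss vs] := subf _ fs; have eq_m := mutual_eq vs.
  exists s; last exact: reach_trans vs.2 rvu.
  split; [by rewrite eq_m | exact: bottom_mutual vs|].
  by exists v => //; rewrite eq_m; apply: mutual_refl.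
rewrite eqEsubset; split=> // b [fb bb [t [rbt rtb] Tt]].
(* The element of [S'] reaching [t] also reaches [b], so it lies in the class of [b] and is the
   vertex chosen there, namely [b]. *)
have [s S's rst] := reachS' t Tt.
have [fs _ _] := subS' _ S's.
have rsb := reach_trans rst rtb.
have bs : mutual b s by split=> //; apply: bb.
rewrite (mutual_eq bs) in fs.
have [_ uniqf _] := fP (S `&` mutual b).
by rewrite (uniqf _ _ fb fs).
Qed.

End Bases.

(** * Specialization to point-bases and arc-bases *)

Section PointArcBases.
Variable D : digraph.

Definition tails : set D := [set u | exists v, arc u v].

Lemma arc_tails (u v : D) : arc u v -> tails u.
Proof. by exists v. Qed.

Lemma point_reachingE : @point_reaching D = target_reaching setT.
Proof.
by apply/funext => S; apply/propext; split=> [H u _|H u]; apply: H.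
Qed.

Lemma arc_reachingE : @arc_reaching D = target_reaching tails.
Proof.
apply/funext => S; apply/propext; split=> [H u [v]|H u v auv]; first exact: H.
by apply: H; exists v.
Qed.

Lemma point_basis_bottom_reaching :
  (exists S : set D, point_basis S) -> bottom_reaching D.
Proof.
move=> [S]; rewrite /point_basis point_reachingE.
exact: target_basis_bottom_reaching.
Qed.

Lemma arc_basis_bottom_reaching :
  (exists S : set D, arc_basis S) -> bottom_reaching D.
Proof.
move=> [S]; rewrite /arc_basis arc_reachingE.
exact/target_basis_bottom_reaching/arc_tails.
Qed.

Lemma point_reaching_basis (S : set D) : bottom_reaching D ->
  point_reaching S -> exists2 B : set D, B `<=` S & point_basis B.
Proof.
rewrite /point_basis point_reachingE.
exact: bottom_reaching_target_basis.
Qed.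

Lemma arc_reaching_basis (S : set D) : bottom_reaching D ->
  arc_reaching S -> exists2 B : set D, B `<=` S & arc_basis B.
Proof.
rewrite /arc_basis arc_reachingE.
exact/bottom_reaching_target_basis/arc_tails.
Qed.

Lemma point_reachingT : point_reaching [set: D].
Proof. by rewrite point_reachingE; apply: target_reachingT. Qed.

Lemma arc_reachingT : arc_reaching [set: D].
Proof. by rewrite arc_reachingE; apply: target_reachingT. Qed.

Lemma bottom_reaching_bases : bottom_reaching D ->
  (exists S : set D, point_basis S) /\ (exists S : set D, arc_basis S).
Proof.
move=> bot.
have [S _ pS] := point_reaching_basis bot point_reachingT.
have [S' _ aS'] := arc_reaching_basis bot arc_reachingT.
by split; [exists S | exists S'].
Qed.

End PointArcBases.

(** * In-rays and finiteness conditions *)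

Section InRays.
Variable D : digraph.

Lemma injective_range_infinite (T : Type) (r : nat -> T) :
  injective r -> ~ finite_set (range r).
Proof.
move=> rinj fin; apply: infinite_nat.
rewrite -(preimage_range r); apply: finite_preimage fin.
by move=> i j _ _; apply: rinj.
Qed.

(** The condensation is acyclic, so its strong subdigraphs have one vertex. Thus a set covered by
    finitely many components is finite, and an in-ray only needs an infinite range. *)
Lemma condensation_strong_finite (C : subdigraph (condensation D)) :
  strong C -> finite_set (sub_vertices C).
Proof.
move=> sC; have [[c Cc] _] := sC.
apply: (@sub_finite_set _ _ [set c]); last exact: finite_set1.
move=> d Cd; apply: condensation_reach_antisym; exact: strong_reachable sC _ _.
Qed.

Lemma backward_walk_in_ray (r : nat -> condensation D) :
  (forall i, arc (r i.+1) (r i)) -> in_ray r.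
Proof.
move=> ar.
have walk i k : reachable (r (k + i)) (r i).
  by elim: k => [|k]; [apply: reach_refl | apply: reach_cons (ar _)].
have rinj : injective r.
  suff lt_neq i j : i < j -> r i <> r j.
    move=> i j eq_r; case: (ltngtP i j) => // lt.
      by case: (lt_neq _ _ lt).
    by case: (lt_neq _ _ lt).
  (* A repetition closes a cycle: [r i], being [r j], reaches [r i.+1], so acyclicity identifies
     these two vertices and makes an arc a loop. *)
  move=> ltij eq_r; have := walk i.+1 (j - i.+1); rewrite subnK // -eq_r => back.
  have eq_c := condensation_reach_antisym back (reach_arc (ar i)).
  by have := ar i; rewrite -eq_c; apply: arc_irrefl.
split=> // -[F [finF subF cover]].
apply: (injective_range_infinite rinj); apply: sub_finite_set cover _.
apply: bigcup_finite => // C /subF[sC _].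
exact: condensation_strong_finite.
Qed.

Lemma no_in_ray_bottom_reaching :
  ~ (exists r : nat -> condensation D, in_ray r) -> bottom_reaching D.
Proof.
move=> noray; apply/bottom_reaching_source => c; apply: contrapT => nosrc.
(* If the shadow of [c] has no source, each of its vertices has a predecessor, again in the shadow.
   The subtype lets the chosen predecessor map be iterated. *)
have pred (d : {d | shadow c d}) :
    exists e : {e | shadow c e}, arc (sval e) (sval d).
  apply: contrapT => none; apply: nosrc; exists (sval d); last exact: svalP d.
  move=> e aed; apply: none.
  by exists (exist _ e (reach_cons aed (svalP d))).
have [f fP] := choice pred.
pose c0 : {d | shadow c d} := exist (shadow c) c (reach_refl _ c).
apply: noray; exists (fun n => sval (iter n f c0)).
by apply: backward_walk_in_ray => i; apply: fP.
Qed.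

Lemma finite_components_no_in_ray :
  finite_set [set C : subdigraph D | strong_component C] ->
  ~ (exists r : nat -> condensation D, in_ray r).
Proof.
move=> fin [r [rinj _ _]].
apply: (@injective_range_infinite _ (fun n => sval (r n))).
  by move=> i j eq_r; apply/rinj/component_sval_inj.
by apply: sub_finite_set fin => _ [n _ <-]; apply: svalP.
Qed.

Lemma finite_strong_components : finite_set [set: D] ->
  finite_set [set C : subdigraph D | strong_component C].
Proof.
move=> /(finite_image (@component_of D)); apply: sub_finite_set.
by move=> C /strong_component_witness[v ->]; exists v.
Qed.

End InRays.

Theorem theorem16 (D : digraph) :
  [<-> (exists S : set D, point_basis S);
       (exists S : set D, arc_basis S);
       (forall u : D, exists C : subdigraph D,
          [/\ strong_component C, initial C & sub_vertices C `<=` shadow u]);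
       (forall u : condensation D, exists2 s : condensation D,
          source s & shadow u s);
       (forall S : set D, point_reaching S ->
          exists2 B : set D, B `<=` S & point_basis B);
       (forall S : set D, arc_reaching S ->
          exists2 B : set D, B `<=` S & arc_basis B)]
  /\
  [/\ (~ (exists r : nat -> condensation D, in_ray r) ->
         (exists S : set D, point_basis S) /\ (exists S : set D, arc_basis S)),
      (finite_set [set C : subdigraph D | strong_component C] ->
         (exists S : set D, point_basis S) /\ (exists S : set D, arc_basis S)) &
      (finite_set [set: D] ->
         (exists S : set D, point_basis S) /\ (exists S : set D, arc_basis S))].
Proof.
split.
  tfae.
  - by move=> /point_basis_bottom_reaching/bottom_reaching_bases[].
  - by move=> /arc_basis_bottom_reaching/bottom_reaching_initial.
  - by move=> /bottom_reaching_initial/bottom_reaching_source.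
  - by move=> /bottom_reaching_source bot S; apply: point_reaching_basis.
  (* Applied to the set of all vertices, the hypothesis yields a point-basis. *)
  - move=> /(_ _ (@point_reachingT D))[B _ pB] S; apply: arc_reaching_basis.
    by apply: point_basis_bottom_reaching; exists B.
  - move=> /(_ _ (@arc_reachingT D))[B _ aB].
    have bot : bottom_reaching D by apply: arc_basis_bottom_reaching; exists B.
    by case: (bottom_reaching_bases bot).
have noray := fun H => bottom_reaching_bases (@no_in_ray_bottom_reaching D H).
have fin := fun H => noray (@finite_components_no_in_ray D H).
by split=> // /finite_strong_components.
Qed.
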